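(* Let $(D,S,F)$ be a POA signature, let $\beta\colon B\to N$ be an nf-homomorphism of $(D\cup S,F)$-algebras and let $\Gamma$ be a $\beta$-coherent set of $(D,S,F)$-transitions. If $\beta'\colon N\to B'$ is a homomorphism of $(D\cup S,F)$-algebras then $\beta'\colon(N,\stackrel{*}{\longrightarrow}_{\Gamma/\beta})\to(B',\stackrel{*}{\longrightarrow}_{\Gamma/B'})$ is a POA homomorphism.
   Context: POA signatures. A POA signature is a triple $(D,S,F)$ with $D\cap S=\emptyset$ and $(D\cup S,F)$ a many-sorted algebraic signature (operation symbols $\sigma\in F_{w\to s}$, with arity $w$ and sort $s$); elements of $D$ are data sorts, elements of $S$ are system sorts. Terms and variables are those of $(D\cup S,F)$. Atoms are equations $t=t'$ between terms of the same sort, and transitions $t\Rightarrow t'$ between terms of the same system sort. A $(D,S,F)$-transition is a Horn sentence $\forall X\, H\to (t\Rightarrow t')$, where $X$ is a set of variables, $H$ is a finite conjunction of atoms (equations and/or transitions), and the atoms are over $(D\cup S,F\cup X)$. $H_=$ is the set of equations and $H_\to$ the set of transitions in $H$, viewed as sets of pairs of terms. Preordered algebras. A preordered $(D,S,F)$-algebra $(A,\leqslant)$ is a $(D\cup S,F)$-algebra $A$ with a preorder $\leqslant_s$ on $A_s$ for each $s\in S$, such that $A_\sigma$ is monotone for each operation symbol $\sigma$ whose result sort is a system sort (arguments of data sorts being compared by equality). A POA homomorphism is a homomorphism of the underlying algebras that is monotone on system sorts. For a sort-respecting map $\theta\colon X\to A$ and a term $t$ over $F\cup X$, $\theta t$ is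 the value of $t$ in $A$ under $\theta$. Algebraic rewriting. A context $c[z]$ is a term $c$ over $(D\cup S,F\cup\{z\})$, where $z$ is a new variable, such that either $c=z$, or $c=\sigma(c_1,\dots,c_n)$ with $\sigma$ an operation symbol of $F$ and exactly one $k\in\{1,\dots,n\}$ such that $c_k$ is a context, the other $c_i$ ($i\neq k$) being just $(D\cup S,F)$-terms. Let $B$ be a $(D\cup S,F)$-algebra. For a context $c[z]$ of sort $s'$ with $z$ of sort $s$, $B_c\colon B_s\to B_{s'}$ is the identity if $c=z$, and $B_c(b)=B_\sigma(B_{c_1},\dots,B_{c_k}(b),\dots,B_{c_n})$ if $c=\sigma(c_1,\dots,c_k[z],\dots,c_n)$. Let $\Delta_B=\{(b,b)\mid b\in B\}$ be the diagonal, and for a relation $\Omega\subseteq B\times B$ let $$\Gamma(\Omega)=\{(B_c(\theta t),B_c(\theta t'))\mid c[z]\text{ a context whose sort is a system sort, with } z \text{ of the sort of } t,t',\ (\forall X\,H\to(t\Rightarrow t'))\in\Gamma,\ \theta\colon X\to B,\ \theta H_=\subseteq\Delta_B,\ \theta H_\to\subseteq\Omega\}.$$ Put $\Gamma_{B,0}=\Delta_B$, $\Gamma_{B,k+1}=\Gamma_{B,k}^*\cup\Gamma(\Gamma_{B,k}^* )$, where $R^*$ is the reflexive-transitive closure of $R$. Define $b\longrightarrow_{\Gamma/B}b'$ iff $(b,b')\in\Gamma(\Gamma_{B,k}^* )$ for some $k\in\omega$, and let $\stackrel{*}{\longrightarrow}_{\Gamma/B}$ be the reflexive-transitive closure of $\longrightarrow_{\Gamma/B}$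 (on data sorts it is equality; in preordered algebras one uses its restriction to system sorts). The same definitions apply to $B'$ in place of $B$. Normal forms and coherence. A homomorphism $\beta\colon B\to N$ of $(D\cup S,F)$-algebras is an nf-homomorphism when $N\subseteq B$ (inclusion of carriers, sort by sort) and $\beta n=n$ for each $n\in N$. The relation $\longrightarrow_{\Gamma/\beta}$ on $N$ is: $n_1\longrightarrow_{\Gamma/\beta}n_2$ iff there is $b_2\in B$ with $n_1\longrightarrow_{\Gamma/B}b_2$ and $\beta b_2=n_2$; $\stackrel{*}{\longrightarrow}_{\Gamma/\beta}$ is its reflexive-transitive closure. $\Gamma$ is $\beta$-coherent when $b_1\longrightarrow_{\Gamma/B}b_2$ implies $\beta b_1\stackrel{*}{\longrightarrow}_{\Gamma/\beta}\beta b_2$.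
   Formalization: Proved: β' is a homomorphism, monotone on system sorts. It is not asserted that (N,→* ) and (B',→* ) are preordered algebras: as contexts have only ground side terms, operations need not be monotone for →* in arbitrary algebras. Where they are, this is the full claim. *)

(* Defs.v *)
From Stdlib Require Import List Relations.

Set Implicit Arguments.
Unset Strict Implicit.
Unset Printing Implicit Defensive.

(** * Many-sorted algebra *)

(** Sorts are the disjoint sum [data + sys], which builds in that data sorts
    and system sorts are disjoint. *)
Record poa_signature := PoaSignature {
  data : Type;
  sys : Type;
  op : list (data + sys) -> data + sys -> Type }.

Definition sort (Sg : poa_signature) : Type := (data Sg + sys Sg)%type.

Definition system (Sg : poa_signature) (s : sys Sg) : sort Sg := inr s.

(** [hlist A w] is the product of the [A s] for [s] in the arity [w]. *)
Inductive hlist (I : Type) (A : I -> Type) : list I -> Type :=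
| hnil : hlist A nil
| hcons (i : I) (w : list I) : A i -> hlist A w -> hlist A (i :: w).

Arguments hnil {I A}.

Definition hmap (I : Type) (A B : I -> Type) (h : forall i, A i -> B i) :=
  fix map_rec (w : list I) (l : hlist A w) : hlist B w :=
    match l with
    | hnil => hnil
    | hcons a l' => hcons (h _ a) (map_rec _ l')
    end.

Record algebra (Sg : poa_signature) := Algebra {
  carrier :> sort Sg -> Type;
  interp : forall (w : list (sort Sg)) (s : sort Sg),
    op w s -> hlist carrier w -> carrier s }.

Definition sorted_map (Sg : poa_signature) (A B : sort Sg -> Type) : Type :=
  forall s, A s -> B s.

Definition is_hom (Sg : poa_signature) (A B : algebra Sg)
    (h : sorted_map A B) : Prop :=
  forall (w : list (sort Sg)) (s : sort Sg) (f : op w s) (l : hlist A w),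
    h s (interp f l) = interp f (hmap h l).

Inductive term (Sg : poa_signature) (X : sort Sg -> Type) : sort Sg -> Type :=
| Var (s : sort Sg) : X s -> term X s
| App (w : list (sort Sg)) (s : sort Sg) :
    op w s -> hlist (term X) w -> term X s.

Fixpoint eval (Sg : poa_signature) (A : algebra Sg) (X : sort Sg -> Type)
    (theta : sorted_map X A) (s : sort Sg) (t : term X s) : A s :=
  match t with
  | Var x => theta _ x
  | App f ts => interp f (hmap (@eval Sg A X theta) ts)
  end.

Definition ground_term (Sg : poa_signature) : sort Sg -> Type :=
  term (fun _ : sort Sg => Empty_set).

Definition ground_eval (Sg : poa_signature) (A : algebra Sg) (s : sort Sg)
    (t : ground_term s) : A s :=
  eval (fun _ (x : Empty_set) => match x with end) t.

(** * Transitions *)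

Inductive atom (Sg : poa_signature) (X : sort Sg -> Type) : Type :=
| Equation (s : sort Sg) : term X s -> term X s -> atom X
| Transition (s : sys Sg) :
    term X (system s) -> term X (system s) -> atom X.

(** The Horn sentence [forall vars, hyps -> (lhs => rhs)]. *)
Record transition (Sg : poa_signature) := HornTransition {
  vars : sort Sg -> Type;
  hyps : list (atom vars);
  tsort : sys Sg;
  lhs : term vars (system tsort);
  rhs : term vars (system tsort) }.

(** * Contexts *)

(** [context z s]: contexts of sort [s] whose hole has sort [z].
    [context_args z w]: lists of arguments of arity [w] of which exactly one is
    a context, all the others being ground terms. *)
Inductive context (Sg : poa_signature) (z : sort Sg) : sort Sg -> Type :=
| Hole : context z z
| CApp (w : list (sort Sg)) (s : sort Sg) :
    op w s -> context_args z w -> context z s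
with context_args (Sg : poa_signature) (z : sort Sg) :
    list (sort Sg) -> Type :=
| CHere (s : sort Sg) (w : list (sort Sg)) :
    context z s -> hlist (@ground_term Sg) w -> context_args z (s :: w)
| CThere (s : sort Sg) (w : list (sort Sg)) :
    ground_term s -> context_args z w -> context_args z (s :: w).

Fixpoint context_eval (Sg : poa_signature) (B : algebra Sg) (z s : sort Sg)
    (c : context z s) : B z -> B s :=
  match c with
  | Hole _ => fun b => b
  | CApp f cs => fun b => interp f (context_args_eval cs b)
  end
with context_args_eval (Sg : poa_signature) (B : algebra Sg) (z : sort Sg)
    (w : list (sort Sg)) (cs : context_args z w) : B z -> hlist B w :=
  match cs with
  | CHere c ts => fun b => hcons (context_eval c b) (hmap (@ground_eval Sg B) ts)
  | CThere t cs' => fun b => hcons (ground_eval B t) (context_args_eval cs' b)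
  end.

(** * Rewriting *)

Definition sorted_rel (Sg : poa_signature) (A : sort Sg -> Type) : Type :=
  forall s, relation (A s).

Definition diag (Sg : poa_signature) (A : sort Sg -> Type) : sorted_rel A :=
  fun s a b => a = b.

Definition star (Sg : poa_signature) (A : sort Sg -> Type)
    (R : sorted_rel A) : sorted_rel A :=
  fun s => clos_refl_trans (A s) (R s).

(** The operator [Omega |-> Gamma(Omega)]. *)
Inductive step (Sg : poa_signature) (Gamma : transition Sg -> Prop)
    (B : algebra Sg) (Omega : sorted_rel B) : sorted_rel B :=
| Step (r : transition Sg) (theta : sorted_map (vars r) B)
    (s' : sys Sg) (c : context (system (tsort r)) (system s')) :
    Gamma r ->
    (forall (s : sort Sg) (t t' : term (vars r) s),
        In (Equation t t') (hyps r) ->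
        diag (eval theta t) (eval theta t')) ->
    (forall (s : sys Sg) (t t' : term (vars r) (system s)),
        In (Transition t t') (hyps r) ->
        Omega (system s) (eval theta t) (eval theta t')) ->
    step Gamma Omega (context_eval c (eval theta (lhs r)))
                     (context_eval c (eval theta (rhs r))).

(** [stage Gamma B k] is Gamma_{B,k}. *)
Fixpoint stage (Sg : poa_signature) (Gamma : transition Sg -> Prop)
    (B : algebra Sg) (k : nat) : sorted_rel B :=
  match k with
  | 0 => @diag Sg B
  | S k' => fun s b b' =>
      star (@stage Sg Gamma B k') b b' \/
      step Gamma (star (@stage Sg Gamma B k')) b b'
  end.

Arguments stage {Sg} Gamma B k s _ _.

Definition rewrites (Sg : poa_signature) (Gamma : transition Sg -> Prop)
    (B : algebra Sg) : sorted_rel B :=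
  fun s b b' => exists k : nat, step Gamma (star (stage Gamma B k)) b b'.

Arguments rewrites {Sg} Gamma B s _ _.

(** * Normal forms and coherence *)

(** The inclusion of carriers N <= B (sort by sort; N need not be a subalgebra
    of B) is given by a family of maps [incl]; its injectivity follows from the
    second condition. *)
Definition is_nf_hom (Sg : poa_signature) (B N : algebra Sg)
    (incl : sorted_map N B) (beta : sorted_map B N) : Prop :=
  is_hom beta /\ forall (s : sort Sg) (n : N s), beta s (incl s n) = n.

Definition nf_rewrites (Sg : poa_signature) (Gamma : transition Sg -> Prop)
    (B N : algebra Sg) (incl : sorted_map N B) (beta : sorted_map B N) :
    sorted_rel N :=
  fun s n1 n2 =>
    exists b2 : B s, rewrites Gamma B s (incl s n1) b2 /\ beta s b2 = n2.

Definition coherent (Sg : poa_signature) (Gamma : transition Sg -> Prop)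
    (B N : algebra Sg) (incl : sorted_map N B) (beta : sorted_map B N) : Prop :=
  forall (s : sort Sg) (b1 b2 : B s),
    rewrites Gamma B s b1 b2 ->
    star (nf_rewrites Gamma incl beta) (beta s b1) (beta s b2).

(** * Preordered algebra homomorphisms *)

(** Only the restrictions of [leA] and [leB] to system sorts matter.  That they
    are compatible with the operations is not part of this predicate: since the
    side arguments of a context are ground terms, [star (rewrites Gamma B)] need
    not be preserved by the operations at elements that are not values of
    ground terms. *)
Definition is_poa_hom (Sg : poa_signature) (A : algebra Sg) (leA : sorted_rel A)
    (B : algebra Sg) (leB : sorted_rel B) (h : sorted_map A B) : Prop :=
  is_hom h /\
  forall (s : sys Sg) (a a' : A (system s)),
    leA (system s) a a' -> leB (system s) (h _ a) (h _ a').

(* Main.v *)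
Require Import Defs.
From Stdlib Require Import Relations.

Set Implicit Arguments.
Unset Strict Implicit.
Unset Printing Implicit Defensive.

(** Algebraic rewriting is natural in the algebra: every homomorphism
    [h : B -> B'] maps [rewrites Gamma B] into [rewrites Gamma B']
    ([rewrites_hom]).  Indeed a rewrite in [B] is given by a transition in
    [Gamma], a valuation [theta] satisfying its hypotheses, and a context; the
    same transition and context with the valuation [h theta] give the image
    rewrite in [B'], because [h] commutes with the evaluation of terms
    ([eval_hom]) and of contexts ([context_eval_hom]).  Rewrites in the
    hypotheses belong to an earlier stage, whence an induction on the stage.

    This is applied to [h = beta' o beta].  A step [n1 --> n2] of the relation
    on [N] is a rewrite [incl n1 --> b2] in [B] with [beta b2 = n2].  As [beta]
    fixes normal forms, [h] maps [incl n1] to [beta' n1] and [b2] to [beta' n2],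
    so [beta' n1 --> beta' n2] in [B'].  Transitive closures are preserved along
    with the relations that they close. *)

Definition preserves (Sg : poa_signature) (A B : sort Sg -> Type)
    (h : sorted_map A B) (R : sorted_rel A) (R' : sorted_rel B) : Prop :=
  forall (s : sort Sg) (a a' : A s), R s a a' -> R' s (h s a) (h s a').

Lemma preserves_star (Sg : poa_signature) (A B : sort Sg -> Type)
    (h : sorted_map A B) (R : sorted_rel A) (R' : sorted_rel B) :
  preserves h R R' -> preserves h (star R) (star R').
Proof.
  intros hR s a a' Haa'.
  induction Haa' as [a a' Haa' | a | a a' a'' _ IH1 _ IH2].
  - apply rt_step, hR, Haa'.
  - apply rt_refl.
  - exact (rt_trans _ _ _ _ _ IH1 IH2).
Qed.

Lemma hmap_hmap (I : Type) (A B C : I -> Type) (f : forall i, A i -> B i)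
    (g : forall i, B i -> C i) (w : list I) (l : hlist A w) :
  hmap g (hmap f l) = hmap (fun i a => g i (f i a)) l.
Proof.
  induction l as [| i w a l IH]; simpl.
  - reflexivity.
  - now rewrite IH.
Qed.

Lemma is_hom_comp (Sg : poa_signature) (A B C : algebra Sg)
    (f : sorted_map A B) (g : sorted_map B C) :
  is_hom f -> is_hom g -> is_hom (fun s a => g s (f s a)).
Proof.
  intros homf homg w s o l.
  now rewrite homf, homg, hmap_hmap.
Qed.

Section Homomorphism.

Variables (Sg : poa_signature) (A B : algebra Sg) (h : sorted_map A B).
Hypothesis homh : is_hom h.

(** The two valuations are related pointwise, rather than by taking [theta'] to
    be [h theta], so that the statement also covers ground terms: the empty
    valuations in [A] and [B] correspond under [h] pointwise, but not
    definitionally. *)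
Lemma eval_hom (X : sort Sg -> Type) (theta : sorted_map X A)
    (theta' : sorted_map X B)
    (hE : forall (s : sort Sg) (x : X s), h (theta s x) = theta' s x) :
  forall (s : sort Sg) (t : term X s), h (eval theta t) = eval theta' t.
Proof.
  (* The induction principle generated for [term] says nothing about the terms
     in an argument list, hence a nested fixpoint. *)
  fix IH 2.
  intros s [s0 x | w s0 f ts]; simpl.
  - apply hE.
  - rewrite homh. f_equal.
    clear f; revert w ts; fix IHs 2.
    intros w [| i w' t ts]; simpl.
    + reflexivity.
    + now rewrite IH, IHs.
Qed.

Lemma ground_eval_hom (s : sort Sg) (t : ground_term s) :
  h (ground_eval A t) = ground_eval B t.
Proof. now apply eval_hom. Qed.

Lemma ground_eval_args_hom (w : list (sort Sg))
    (ts : hlist (@ground_term Sg) w) :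
  hmap h (hmap (@ground_eval Sg A) ts) = hmap (@ground_eval Sg B) ts.
Proof.
  induction ts as [| s w t ts IH]; simpl.
  - reflexivity.
  - now rewrite ground_eval_hom, IH.
Qed.

(** Homomorphisms preserve the side arguments of a context because these are
    ground terms, whose values do not depend on a valuation. *)
Fixpoint context_eval_hom (z s : sort Sg) (c : context z s) (a : A z) :
  h (context_eval c a) = context_eval c (h a)
with context_args_eval_hom (z : sort Sg) (w : list (sort Sg))
    (cs : context_args z w) (a : A z) :
  hmap h (context_args_eval cs a) = context_args_eval cs (h a).
Proof.
  - destruct c as [| w s f cs]; simpl.
    + reflexivity.
    + now rewrite homh, context_args_eval_hom.
  - destruct cs as [s w c ts | s w t cs]; simpl.
    + now rewrite context_eval_hom, ground_eval_args_hom.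
    + now rewrite ground_eval_hom, context_args_eval_hom.
Qed.

(** The image of a step uses the same transition and context, and the valuation
    composed with [h]; the hypotheses of the transition carry over because its
    equations are preserved by [h], and its transitions by assumption. *)
Lemma step_hom (Gamma : transition Sg -> Prop)
    (Omega : sorted_rel A) (Omega' : sorted_rel B) :
  preserves h Omega Omega' ->
  preserves h (step Gamma Omega) (step Gamma Omega').
Proof.
  intros hOmega s a a' [r theta s' c Hr Heq Htr].
  set (theta' := (fun s x => h (theta s x)) : sorted_map (vars r) B).
  assert (Heval : forall s (t : term (vars r) s),
             h (eval theta t) = eval theta' t)
    by (now apply eval_hom).
  rewrite !context_eval_hom, !Heval.
  apply Step.
  - exact Hr.
  - intros s0 t t' Hin. unfold diag.
    now rewrite <- !Heval, (Heq _ _ _ Hin).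
  - intros s0 t t' Hin.
    rewrite <- !Heval. now apply hOmega, Htr.
Qed.

Lemma stage_hom (Gamma : transition Sg -> Prop) (k : nat) :
  preserves h (stage Gamma A k) (stage Gamma B k).
Proof.
  induction k as [| k IH]; intros s a a'; simpl.
  - intros Haa'. exact (f_equal (@h s) Haa').
  - intros [Haa' | Haa'].
    + left. exact (preserves_star IH Haa').
    + right. exact (step_hom (preserves_star IH) Haa').
Qed.

Lemma rewrites_hom (Gamma : transition Sg -> Prop) :
  preserves h (rewrites Gamma A) (rewrites Gamma B).
Proof.
  intros s a a' [k Haa']. exists k.
  exact (step_hom (preserves_star (stage_hom (k := k))) Haa').
Qed.

End Homomorphism.

Theorem proposition5p3 (Sg : poa_signature) (B N : algebra Sg)
    (incl : sorted_map N B) (beta : sorted_map B N)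
    (Gamma : transition Sg -> Prop)
    (nf_beta : is_nf_hom incl beta)
    (coh_beta : coherent Gamma incl beta)
    (B' : algebra Sg) (beta' : sorted_map N B')
    (hom_beta' : is_hom beta') :
  is_poa_hom (star (nf_rewrites Gamma incl beta))
             (star (rewrites Gamma B'))
             beta'.
Proof.
  destruct nf_beta as [hom_beta beta_incl].
  split; [exact hom_beta' |].
  intros s.
  apply preserves_star.
  intros s0 n1 n2 [b2 [Hrew Hb2]].
  rewrite <- (beta_incl _ n1), <- Hb2.
  exact (rewrites_hom (is_hom_comp hom_beta hom_beta') Hrew).
Qed.
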